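(* Let $f\neq -z$ be pseudo-involutory. Then a Riordan array $(g,f)$ is a pseudo-involution if and only if $g=\pm\exp(\phi(\sqrt{zf}))$ for some odd function $\phi=\phi(z)\in\mathbb{R}[[z]]$ (and here $\phi$ may be an arbitrary odd power series).
   Context: $\mathcal{F}_k$ denotes the set of formal power series in $\mathbb{R}[[z]]$ of order exactly $k$. A Riordan array is a pair $(g,f)\in\mathcal{F}_0\times\mathcal{F}_1$, identified with the infinite lower triangular matrix whose $k$-th column has generating function $gf^k$; the product is $(g,f)(G,F)=(g\cdot(G\circ f),F\circ f)$, with identity $(1,z)$. A Riordan array $(g,f)$ is a pseudo-involution if $(g,-f)=(g,f)(1,-z)$ satisfies $(g,-f)^2=(1,z)$. A function $f\in\mathcal{F}_1$ is pseudo-involutory if $-f$ is a compositional involution (equivalently, $f$ is the second component of some pseudo-involution $(g,f)$). If $f\ne -z$ is pseudo-involutory then $f'(0)=1$, and $\sqrt{zf}=z\sqrt{f/z}\in\mathcal{F}_1$ is the square root of $zf$ with leading coefficient $1$. A power series $\phi$ is odd if $\phi(-z)=-\phi(z)$. *)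

(* Defs.v *)
From HB Require Import structures.
From mathcomp Require Import all_boot all_order all_algebra.
From mathcomp Require Import boolp reals.

Set Implicit Arguments.
Unset Strict Implicit.
Unset Printing Implicit Defensive.

Import Order.TTheory GRing.Theory Num.Theory.
Local Open Scope ring_scope.

(* A record rather than [nat -> R], so that the product is the Cauchy product
   and not the pointwise product of functions. *)
Record fps (R : Type) := FPS { coef_fps :> nat -> R }.

Lemma fpsP (R : Type) (a b : fps R) : (forall n, a n = b n) -> a = b.
Proof. by case: a b => [a] [b] /= ab; congr FPS; apply/funext. Qed.

HB.instance Definition _ (R : Type) := gen_eqMixin (fps R).
HB.instance Definition _ (R : Type) := gen_choiceMixin (fps R).

Section FpsRing.
Variable R : comNzRingType.
Implicit Types a b c : fps R.

Definition fps_add a b : fps R := FPS (fun n => a n + b n).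
Definition fps_opp a : fps R := FPS (fun n => - a n).
Definition fps_mul a b : fps R :=
  FPS (fun n => \sum_(i < n.+1) a i * b (n - i)%N).
Definition fpsC (x : R) : fps R := FPS (fun n => if n == 0%N then x else 0).

Fact fps_addA : associative fps_add.
Proof. by move=> a b c; apply: fpsP => n /=; rewrite addrA. Qed.
Fact fps_addC : commutative fps_add.
Proof. by move=> a b; apply: fpsP => n /=; rewrite addrC. Qed.
Fact fps_add0 : left_id (fpsC 0) fps_add.
Proof. by move=> a; apply: fpsP => n /=; rewrite if_same add0r. Qed.
Fact fps_addN : left_inverse (fpsC 0) fps_opp fps_add.
Proof. by move=> a; apply: fpsP => n /=; rewrite if_same addNr. Qed.

HB.instance Definition _ :=
  GRing.isZmodule.Build (fps R) fps_addA fps_addC fps_add0 fps_addN.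

Let tr n a : {poly R} := \poly_(i < n.+1) a i.

Let trE n a i : (i <= n)%N -> (tr n a)`_i = a i.
Proof. by move=> le_in; rewrite coef_poly ltnS le_in. Qed.

Let trM n a b i : (i <= n)%N -> fps_mul a b i = (tr n a * tr n b)`_i.
Proof.
move=> le_in; rewrite coefM; apply: eq_bigr => j _.
have le_ji : (j <= i)%N by rewrite -ltnS.
by rewrite !trE // (leq_trans _ le_in) // leq_subr.
Qed.

Fact fps_mulA : associative fps_mul.
Proof.
have le_ord n (j : 'I_n.+1) : (j <= n)%N by rewrite -ltnS.
move=> a b c; apply: fpsP => n; transitivity ((tr n a * (tr n b * tr n c))`_n).
  rewrite coefM; apply: eq_bigr => j _.
  by rewrite trE // -trM // leq_subr.
rewrite mulrA coefM; apply: eq_bigr => j _.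
by rewrite -trM // trE // leq_subr.
Qed.
Fact fps_mulC : commutative fps_mul.
Proof. by move=> a b; apply: fpsP => n; rewrite !(trM _ _ (leqnn n)) mulrC. Qed.
Fact fps_mul1 : left_id (fpsC 1) fps_mul.
Proof.
move=> a; apply: fpsP => n /=.
by rewrite big_ord_recl /= mul1r subn0 big1 ?addr0 // => i _; rewrite mul0r.
Qed.
Fact fps_mulD : left_distributive fps_mul fps_add.
Proof.
move=> a b c; apply: fpsP => n /=; rewrite -big_split /=.
by apply: eq_bigr => i _; rewrite mulrDl.
Qed.
Fact fps_1neq0 : fpsC 1 != 0.
Proof.
apply/eqP => /(congr1 (fun a : fps R => a 0%N)) /eqP /=.
by rewrite (negPf (oner_neq0 R)).
Qed.

HB.instance Definition _ := GRing.Zmodule_isComNzRing.Build (fps R)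
  fps_mulA fps_mulC fps_mul1 fps_mulD fps_1neq0.

Lemma fpsDE a b n : (a + b) n = a n + b n. Proof. by []. Qed.
Lemma fpsNE a n : (- a) n = - a n. Proof. by []. Qed.
Lemma fpsME a b n : (a * b) n = \sum_(i < n.+1) a i * b (n - i)%N.
Proof. by []. Qed.
Lemma fps1E n : (1 : fps R) n = (n == 0%N)%:R.
Proof. by rewrite /=; case: (n == 0%N). Qed.

Definition fpsX : fps R := FPS (fun n => (n == 1%N)%:R).

Definition has_order (k : nat) a : Prop :=
  (forall i, (i < k)%N -> a i = 0) /\ a k != 0.

Lemma fpsXE n : fpsX n = (n == 1%N)%:R. Proof. by []. Qed.

(* The substitution g(f(z)); it is meaningful only when f has zero constant
   term, in which case f ^+ k has no term of degree < k, so that the sum over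
   all k reduces to k <= n in degree n. *)
Definition fps_comp (g f : fps R) : fps R :=
  FPS (fun n => \sum_(k < n.+1) g k * (f ^+ k) n).

Lemma fps_compE g f n : fps_comp g f n = \sum_(k < n.+1) g k * (f ^+ k) n.
Proof. by []. Qed.

Definition fps_odd a : Prop := fps_comp a (- fpsX) = - a.

(* a / z, for a with zero constant term *)
Definition fps_divX a : fps R := FPS (fun n => a n.+1).

Definition riordan (A : fps R * fps R) : Prop :=
  has_order 0 A.1 /\ has_order 1 A.2.

Definition riordan_mul (A B : fps R * fps R) : fps R * fps R :=
  (A.1 * fps_comp B.1 A.2, fps_comp B.2 A.2).

Definition riordan_one : fps R * fps R := (1, fpsX).

Definition pseudo_involution (A : fps R * fps R) : Prop :=
  let B := riordan_mul A (1, - fpsX) in riordan_mul B B = riordan_one.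

Definition pseudo_involutory (f : fps R) : Prop :=
  has_order 1 f /\ fps_comp (- f) (- f) = fpsX.

End FpsRing.

Arguments fpsX {R}.
Arguments riordan_one {R}.

(* (g, f)(1, -z) = (g, -f) *)
Lemma riordan_mulNX (R : comNzRingType) (g f : fps R) :
  has_order 1 f -> riordan_mul (g, f) (1, - fpsX) = (g, - f).
Proof.
move=> [/(_ 0%N isT) f0 _]; congr pair; apply: fpsP => n.
  have -> : fps_comp 1 f = 1; last by rewrite mulr1.
  apply: fpsP => m; rewrite fps_compE big_ord_recl fps1E mul1r expr0.
  rewrite big1 ?addr0 //.
  by move=> i _; rewrite fps1E mul0r.
rewrite fps_compE; case: n => [|n].
  by rewrite big_ord_recl big_ord0 addr0 !fpsNE f0 fpsXE oppr0 mul0r.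
rewrite 2!big_ord_recl !fpsNE !fpsXE big1 => [|i _].
  by rewrite addr0 oppr0 mul0r add0r mulN1r expr1.
by rewrite fpsNE fpsXE oppr0 mul0r.
Qed.

Section FpsSqrtExp.
Variable R : numFieldType.
Implicit Types a f : fps R.

(* The first n coefficients s_0 = 1, s_1, ... of the square root of a with
   constant term 1, by solving a_m = \sum_(i <= m) s_i s_(m-i) for s_m. *)
Fixpoint sqrt_coefs a (n : nat) : seq R :=
  if n is m.+1 then
    let s := sqrt_coefs a m in
    rcons s (if m == 0%N then 1
             else (a m - \sum_(1 <= i < m) s`_i * s`_(m - i)) / 2)
  else [::].

(* The square root of a with constant term 1, for a with constant term 1. *)
Definition fps_sqrt a : fps R := FPS (fun n => (sqrt_coefs a n.+1)`_n).

Lemma size_sqrt_coefs a n : size (sqrt_coefs a n) = n.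
Proof. by elim: n => //= n IHn; rewrite size_rcons IHn. Qed.

Lemma nth_sqrt_coefs a n i : (i < n)%N -> (sqrt_coefs a n)`_i = fps_sqrt a i.
Proof.
elim: n => // n IHn; rewrite ltnS leq_eqVlt => /predU1P[-> //|lt_in].
by rewrite -IHn //= nth_rcons size_sqrt_coefs lt_in.
Qed.

Lemma fps_sqrt0 a : fps_sqrt a 0%N = 1. Proof. by []. Qed.

Lemma fps_sqrtS a n : fps_sqrt a n.+1 =
  (a n.+1 - \sum_(1 <= i < n.+1) fps_sqrt a i * fps_sqrt a (n.+1 - i)%N) / 2.
Proof.
rewrite {1}/fps_sqrt /coef_fps.
have -> : sqrt_coefs a n.+2 = rcons (sqrt_coefs a n.+1)
  ((a n.+1 - \sum_(1 <= i < n.+1)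
    (sqrt_coefs a n.+1)`_i * (sqrt_coefs a n.+1)`_(n.+1 - i)) / 2) by [].
rewrite nth_rcons size_sqrt_coefs ltnn eqxx; congr ((_ - _) / _).
rewrite !big_nat; apply: eq_bigr => i /andP[i_gt0 lt_in].
by rewrite !nth_sqrt_coefs // ltn_subrL i_gt0.
Qed.

Lemma fps_sqr_sqrt a : a 0%N = 1 -> fps_sqrt a ^+ 2 = a.
Proof.
move=> a0; apply: fpsP => -[|n]; rewrite expr2 fpsME.
  by rewrite big_ord_recl big_ord0 subnn fps_sqrt0 mulr1 addr0 a0.
rewrite -(big_mkord xpredT
  (fun i => fps_sqrt a i * fps_sqrt a (n.+1 - i)%N)).
rewrite big_nat_recr // big_ltn // subn0 subnn.
rewrite !fps_sqrt0 mul1r mulr1 -[LHS]/(_ + _ + _) addrAC.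
rewrite -mulr2n -mulr_natr fps_sqrtS.
by rewrite divfK ?pnatr_eq0 // subrK.
Qed.

(* sqrt(z f) := z sqrt(f / z) *)
Definition sqrtXf f : fps R := fpsX * fps_sqrt (fps_divX f).

Definition exp_series : fps R := FPS (fun n => (n`!)%:R^-1).

(* exp(a), for a with zero constant term (in particular for a odd) *)
Definition fps_exp a : fps R := fps_comp exp_series a.

Lemma fps_mulX_divX f : f 0%N = 0 -> fpsX * fps_divX f = f.
Proof.
move=> f0; apply: fpsP => -[|n]; rewrite fpsME.
  by rewrite big_ord_recl big_ord0 /= mul0r addr0 f0.
rewrite 2!big_ord_recl /= mul0r add0r mul1r subSS subn0 big1 ?addr0 //.
by move=> i _; rewrite mul0r.
Qed.

Lemma sqrtXf_sqr f : f 0%N = 0 -> f 1%N = 1 -> sqrtXf f ^+ 2 = fpsX * f.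
Proof.
by move=> f0 f1; rewrite exprMn fps_sqr_sqrt // expr2 -mulrA fps_mulX_divX.
Qed.

Lemma sqrtXf_coef0 f : sqrtXf f 0%N = 0.
Proof. by rewrite fpsME big_ord_recl big_ord0 /= mul0r addr0. Qed.

Lemma sqrtXf_coef1 f : sqrtXf f 1%N = 1.
Proof. by rewrite fpsME 2!big_ord_recl big_ord0 /= mul0r mulr1 add0r addr0. Qed.

End FpsSqrtExp.

(* Main.v *)
(* Write h = - f, an involution under composition, and s = sqrt(z f).  Since
   (g, - f) squares to (g * (g o h), z), the pseudo-involutions (g, f) are the
   solutions of g * (g o h) = 1.  The series z f is invariant under h, so that
   s o h is a square root of s ^ 2, and comparing leading coefficients gives
   s o h = - s: in the coordinate s, the involution h is w |-> - w.  Up to sign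
   g = exp(l), the equation becomes l o h = - l, that is, phi = l o s^-1 is
   odd. *)
Require Import Defs.
From mathcomp Require Import all_boot all_order all_algebra.
From mathcomp Require Import reals ring.
Import GRing.Theory.
Local Open Scope ring_scope.

Set Implicit Arguments.
Unset Strict Implicit.
Unset Printing Implicit Defensive.

(** * Substitution of power series: ring morphism laws, unit laws and associativity *)

Section Composition.
Context {R : comNzRingType}.
Implicit Types (a b f h : fps R) (n : nat).

Lemma fps_mulCE (x : R) a n : (fpsC x * a) n = x * a n.
Proof.
by rewrite fpsME big_ord_recl subn0 big1 ?addr0 // => i _; rewrite mul0r.
Qed.

Lemma fps_mulE0 a b : (a * b) 0%N = a 0%N * b 0%N.
Proof. by rewrite fpsME big_ord_recl big_ord0 addr0. Qed.

Lemma fps_mulXE a n : (fpsX * a) n.+1 = a n.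
Proof.
rewrite fpsME 2!big_ord_recl mul0r mul1r subSS subn0 add0r.
by rewrite big1 ?addr0 // => i _; rewrite mul0r.
Qed.

Lemma fps_sumE (I : Type) (r : seq I) (P : pred I) (F : I -> fps R) n :
  (\sum_(i <- r | P i) F i) n = \sum_(i <- r | P i) F i n.
Proof.
apply: (big_morph (fun a : fps R => a n)) => // .
by case: n.
Qed.

(** Multiplication by a series without constant term shifts degrees up; this gain of one degree
    drives the inductions below. *)
Lemma eq_fps_mulr f a b n : f 0%N = 0 ->
  (forall i, (i < n)%N -> a i = b i) -> (f * a) n = (f * b) n.
Proof.
move=> f0 eq_ab; rewrite !fpsME; apply: eq_bigr => -[[|i] /= lt_in] _.
  by rewrite f0 !mul0r.
by rewrite eq_ab // ltn_subrL /=; case: (n) lt_in.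
Qed.

Lemma fps_expr_lt f k n : f 0%N = 0 -> (n < k)%N -> (f ^+ k) n = 0.
Proof.
move=> f0; elim: k n => // k IHk n; rewrite ltnS exprS => le_nk.
rewrite (@eq_fps_mulr _ _ 0) ?mulr0; first by case: n {le_nk}.
- exact: f0.
- by move=> i lt_in; rewrite IHk ?(leq_trans lt_in) //; case: (i).
Qed.

Lemma fps_expr_diag f n : f 0%N = 0 -> (f ^+ n) n = f 1%N ^+ n.
Proof.
move=> f0; elim: n => [//|n IHn]; rewrite exprS fpsME.
rewrite 2!big_ord_recl f0 mul0r add0r /= subSS subn0 IHn -exprS.
rewrite big1 ?addr0 // => i _.
rewrite fps_expr_lt ?mulr0 // /bump /= !add1n subSS ltn_subrL.
by case: (n) i => [[]|].
Qed.

(** The extra terms vanish because [f ^+ k] starts in degree [k]. A single bound [N] can then serve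
    all degrees below it. *)
Lemma fps_comp_trunc a f N n : f 0%N = 0 -> (n < N)%N ->
  fps_comp a f n = (\sum_(k < N) fpsC (a k) * f ^+ k) n.
Proof.
move=> f0 lt_nN; rewrite fps_compE fps_sumE.
rewrite (big_ord_widen N (fun k => a k * (f ^+ k) n)) // big_mkcond.
apply: eq_bigr => k _; rewrite fps_mulCE; case: ifPn => //.
by rewrite -leqNgt => lt_nk; rewrite fps_expr_lt ?mulr0.
Qed.

(** A Horner step: substitute [f] into a = a_0 + z (a / z). *)
Lemma fps_comp_divX a f : f 0%N = 0 ->
  fps_comp a f = fpsC (a 0%N) + f * fps_comp (fps_divX a) f.
Proof.
move=> f0; apply: fpsP => n; rewrite (@fps_comp_trunc _ _ n.+1) //.
rewrite big_ord_recl expr0 mulr1 !fpsDE; congr (_ + _).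
rewrite (@eq_fps_mulr _ _ (\sum_(k < n) fpsC (fps_divX a k) * f ^+ k)) //.
  rewrite mulr_sumr; congr (coef_fps _ _); apply: eq_bigr => i _.
  by rewrite mulrCA -exprS.
by move=> i lt_in; apply: fps_comp_trunc.
Qed.

(** The factor [f] makes degree [n] of [F a] depend only on lower degrees of [F (fps_divX a)], so
    the Horner recursion has one solution. Identities between compositions then follow by checking
    that both sides satisfy it. *)
Lemma fps_divX_rec_uniq f h (F G : fps R -> fps R) : f 0%N = 0 ->
  (forall a, F a = fpsC (a 0%N) * h + f * F (fps_divX a)) ->
  (forall a, G a = fpsC (a 0%N) * h + f * G (fps_divX a)) ->
  F =1 G.
Proof.
move=> f0 recF recG a; apply: fpsP => n.
elim/ltn_ind: n a => n IHn a; rewrite recF recG !fpsDE; congr (_ + _).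
by apply: eq_fps_mulr => // i lt_in; apply: IHn.
Qed.

Lemma fps_divXK a : a = fpsC (a 0%N) + fpsX * fps_divX a.
Proof.
apply: fpsP => -[|n]; rewrite fpsDE.
  by rewrite fps_mulE0 mul0r addr0.
by rewrite fps_mulXE add0r.
Qed.

Lemma fps_comp_coef0 a f : fps_comp a f 0%N = a 0%N.
Proof. by rewrite fps_compE big_ord_recl big_ord0 addr0 mulr1. Qed.

Lemma fps_comp_coef1 a f : fps_comp a f 1%N = a 1%N * f 1%N.
Proof.
by rewrite fps_compE 2!big_ord_recl big_ord0 addr0 mulr0 add0r.
Qed.

Lemma fps_compD a b f : fps_comp (a + b) f = fps_comp a f + fps_comp b f.
Proof.
apply: fpsP => n; rewrite fpsDE !fps_compE -big_split /=.
by apply: eq_bigr => k _; rewrite mulrDl.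
Qed.

Lemma fps_compN a f : fps_comp (- a) f = - fps_comp a f.
Proof.
apply: fpsP => n; rewrite fpsNE !fps_compE -sumrN.
by apply: eq_bigr => k _; rewrite mulNr.
Qed.

Lemma fps_compC (x : R) f : fps_comp (fpsC x) f = fpsC x.
Proof.
apply: fpsP => n; rewrite fps_compE big_ord_recl big1 ?addr0.
  by rewrite expr0 -(fps_mulCE x 1) mulr1.
by move=> i _; rewrite mul0r.
Qed.

Lemma fps_comp1 f : fps_comp 1 f = 1.
Proof. exact: fps_compC. Qed.

Lemma fps_compM a b f : f 0%N = 0 ->
  fps_comp (a * b) f = fps_comp a f * fps_comp b f.
Proof.
move=> f0.
(* The recursion runs on [a] with [b] fixed; [h] is the common value of both sides at [a = 1]. *)
apply: (@fps_divX_rec_uniq f (fps_comp b f)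
  (fun a => fps_comp (a * b) f) (fun a => fps_comp a f * fps_comp b f)) => //.
- move=> c; have cb0 x : fps_comp (fpsC x * b) f = fpsC x * fps_comp b f.
    apply: fpsP => n; rewrite fps_mulCE !fps_compE mulr_sumr.
    by apply: eq_bigr => k _; rewrite fps_mulCE mulrA.
  rewrite {1}(fps_divXK c) mulrDl fps_compD cb0; congr (_ + _).
  rewrite -mulrA fps_comp_divX // fps_mulE0 mul0r.
  have -> : fpsC (0 : R) = 0 by [].
  rewrite add0r; congr (_ * fps_comp _ _).
  by apply: fpsP => n; apply: fps_mulXE.
- by move=> c; rewrite {1}fps_comp_divX // mulrDl mulrA.
Qed.

Lemma fps_compX a : fps_comp a fpsX = a.
Proof.
suff: (fun b : fps R => fps_comp b fpsX) =1 id by apply.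
apply: (@fps_divX_rec_uniq fpsX 1) => // c.
  by rewrite mulr1 -fps_comp_divX.
by rewrite mulr1 -fps_divXK.
Qed.

Lemma fps_comp_Xl f : f 0%N = 0 -> fps_comp fpsX f = f.
Proof.
move=> f0; rewrite fps_comp_divX //.
have -> : fps_divX fpsX = 1 :> fps R.
  by apply: fpsP => n; rewrite fps1E.
by rewrite fps_comp1 mulr1; apply: add0r.
Qed.

Lemma fps_compA a f h : f 0%N = 0 -> h 0%N = 0 ->
  fps_comp (fps_comp a f) h = fps_comp a (fps_comp f h).
Proof.
move=> f0 h0; have fh0 : fps_comp f h 0%N = 0 by rewrite fps_comp_coef0.
apply: (@fps_divX_rec_uniq (fps_comp f h) 1
  (fun a => fps_comp (fps_comp a f) h)
  (fun a => fps_comp a (fps_comp f h))) => // c.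
  by rewrite mulr1 (@fps_comp_divX c) // fps_compD fps_compC fps_compM.
by rewrite mulr1 -fps_comp_divX.
Qed.

Lemma fps_comp_oppX a n : fps_comp a (- fpsX) n = (- 1) ^+ n * a n.
Proof.
have X0 : (- fpsX : fps R) 0%N = 0 by apply: oppr0.
elim: n a => [|n IHn] a; first by rewrite fps_comp_coef0 mul1r.
rewrite fps_comp_divX // fpsDE add0r mulNr fpsNE fps_mulXE.
by rewrite IHn exprS mulN1r mulNr.
Qed.

Lemma fps_odd_compN a f : f 0%N = 0 -> fps_odd a ->
  fps_comp a (- f) = - fps_comp a f.
Proof.
move=> f0 odd_a; rewrite -fps_compN -odd_a fps_compA ?fps_compN ?fps_comp_Xl //.
exact: oppr0.
Qed.

End Composition.

(** * Compositional inverses, cancellation, and the equation for [g] *)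

Section Inverse.
Context {R : fieldType}.
Implicit Types (a b f h : fps R).

(** Iterate [Phi] from the zero sequence: entry [n] is stable from iteration [n.+1] on. *)
Lemma exists_course_of_values (Phi : nat -> (nat -> R) -> R) :
  (forall n u v, (forall m, (m < n)%N -> u m = v m) -> Phi n u = Phi n v) ->
  exists u, forall n, u n = Phi n u.
Proof.
move=> extPhi; pose it k := iter k (fun u n => Phi n u) (fun=> 0).
have it_stable k l n : (n < k)%N -> (n < l)%N -> it k n = it l n.
  elim: k l n => // k IHk [|l] n //; rewrite !ltnS => le_nk le_nl.
  apply: extPhi => m lt_mn.
  by apply: IHk; [apply: leq_trans le_nk | apply: leq_trans le_nl].
exists (fun n => it n.+1 n) => n; apply: extPhi => m lt_mn.
exact: it_stable.
Qed.

(** The coefficients of [b] solve a triangular linear system whose diagonal entries are the nonzero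
    powers [f 1%N ^+ n]. *)
Lemma fps_comp_surj f a : has_order 1 f -> exists b, fps_comp b f = a.
Proof.
case=> /(_ 0%N isT) f0 f1.
have [n u v eq_uv|u uE] := @exists_course_of_values (fun n u =>
  (a n - \sum_(k < n) u k * (f ^+ k) n) / f 1%N ^+ n).
  by congr ((_ - _) / _); apply: eq_bigr => k _; rewrite eq_uv.
exists (FPS u); apply: fpsP => n; rewrite fps_compE big_ord_recr /=.
by rewrite fps_expr_diag // uE divfK ?expf_neq0 // addrC subrK.
Qed.

(** Surjectivity gives a left inverse [h] of [f], then a left inverse [u] of [h]; associativity
    forces [u = f]. *)
Lemma fps_comp_inverse f : has_order 1 f ->
  exists h, [/\ h 0%N = 0, fps_comp h f = fpsX & fps_comp f h = fpsX].
Proof.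
move=> ord_f; have [f0 f1] := ord_f.
have [h hf] := fps_comp_surj fpsX ord_f.
have h0 : h 0%N = 0 by rewrite -(fps_comp_coef0 h f) hf.
have h1 : h 1%N != 0.
  apply/eqP => h1; have := fps_comp_coef1 h f.
  by rewrite hf h1 mul0r => /eqP; rewrite oner_eq0.
have [|u uh] := @fps_comp_surj h fpsX; first by split=> // -[].
have uf : u = f.
  rewrite -[u]fps_compX -hf -fps_compA //; last exact: f0.
  by rewrite uh fps_comp_Xl //; apply: f0.
by exists h; rewrite -{2}uf.
Qed.

Lemma fps_mulI f a : has_order 1 f -> f * a = 0 -> a = 0.
Proof.
case=> /(_ 0%N isT) f0 f1 fa0; apply: fpsP => n.
elim/ltn_ind: n => n IHn.
have := congr1 (fun b : fps R => b n.+1) fa0; rewrite fpsME 2!big_ord_recl.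
rewrite f0 mul0r add0r subSS subn0 big1 ?addr0 => [|[i lt_in] _].
  by move=> /eqP; rewrite mulf_eq0 (negPf f1) /= => /eqP->; case: (n).
rewrite /= subSS IHn ?mulr0 //; last first.
  by rewrite ltn_subrL /=; case: (n) lt_in.
by case: (_ - _)%N => [|?] /=; rewrite mulr0.
Qed.

(** As - f is an involution, the second component of the square is already z; only the first imposes
    a condition. *)
Lemma pseudo_involutionE (f g : fps R) : pseudo_involutory f ->
  pseudo_involution (g, f) <-> g * fps_comp g (- f) = 1.
Proof.
case=> ord_f ff; rewrite /pseudo_involution riordan_mulNX // /riordan_mul /= ff.
by split=> [/(congr1 fst)|->].
Qed.

End Inverse.

(** * Exponential and logarithm *)

Section Exponential.
Context {R : numFieldType}.
Implicit Types (a b f g phi : fps R).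

Lemma exp_series_oppX :
  exp_series R * fps_comp (exp_series R) (- fpsX) = 1.
Proof.
apply: fpsP => n; rewrite fps1E fpsME.
have fact_neq0 m : (m`!)%:R != 0 :> R.
  by rewrite Num.Theory.pnatr_eq0 -lt0n fact_gt0.
apply: (mulfI (fact_neq0 n)).
(* Multiplied by n!, the Cauchy product becomes the binomial expansion of this power. *)
transitivity ((- 1 + 1) ^+ n : R); last first.
  by rewrite addNr expr0n; case: n => [|n]; rewrite ?mulr1 ?mulr0.
have expE m : exp_series R m = (m`!)%:R^-1 by [].
rewrite exprDn mulr_sumr; apply: eq_bigr => -[i le_in] _.
rewrite fps_comp_oppX !expE -(@bin_fact n i) // !natrM.
rewrite expr1n mulr1 -mulr_natr.
by field; rewrite !fact_neq0.
Qed.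

Lemma fps_exp_coef0 a : fps_exp a 0%N = 1.
Proof. by rewrite /fps_exp fps_comp_coef0 /= invr1. Qed.

Lemma fps_expN a : a 0%N = 0 -> fps_exp a * fps_exp (- a) = 1.
Proof.
move=> a0; have X0 : (- fpsX : fps R) 0%N = 0 by apply: oppr0.
rewrite /fps_exp -{2}(fps_comp_Xl a0) -fps_compN -fps_compA //.
by rewrite -fps_compM // exp_series_oppX fps_comp1.
Qed.

Lemma fps_comp_exp a f : a 0%N = 0 -> f 0%N = 0 ->
  fps_comp (fps_exp a) f = fps_exp (fps_comp a f).
Proof. exact: fps_compA. Qed.

(** Here [l] is log(1 + z), obtained as the compositional inverse of exp(z) - 1. *)
Lemma fps_logarithm : exists l : fps R, [/\ l 0%N = 0,
  forall a, a 0%N = 0 -> fps_comp l (fps_exp a - 1) = a &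
  forall g, g 0%N = 1 -> fps_exp (fps_comp l (g - 1)) = g].
Proof.
pose e := exp_series R - 1.
have eE a : fps_exp a - 1 = fps_comp e a.
  by rewrite fps_compD fps_compN fps_comp1.
have e0 : e 0%N = 0 by rewrite fpsDE /= invr1 subrr.
have [|l [l0 le el]] := @fps_comp_inverse _ e.
  split=> [[] //|]; rewrite fpsDE /= invr1 oppr0 addr0; exact: oner_neq0.
exists l; split=> // [a a0|g g0].
  by rewrite eE -fps_compA // le fps_comp_Xl.
have g10 : (g - 1) 0%N = 0 by rewrite fpsDE g0 /= subrr.
apply: (addIr (- 1)); rewrite eE -fps_compA // el fps_comp_Xl //.
Qed.

Lemma fps_exp_inj a b : a 0%N = 0 -> b 0%N = 0 ->
  fps_exp a = fps_exp b -> a = b.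
Proof.
have [l [_ expK _]] := fps_logarithm.
by move=> a0 b0 eq_ab; rewrite -(expK a) // eq_ab expK.
Qed.

Lemma fps_exp_surj g : g 0%N = 1 -> exists2 a : fps R, a 0%N = 0 & g = fps_exp a.
Proof.
have [l [l0 _ logK]] := fps_logarithm => g0.
by exists (fps_comp l (g - 1)); rewrite ?fps_comp_coef0 ?logK.
Qed.

Lemma fps_odd_coef0 phi : fps_odd phi -> phi 0%N = 0.
Proof.
move=> /(congr1 (fun a : fps R => a 0%N)).
rewrite fps_comp_coef0 fpsNE => /eqP.
by rewrite -subr_eq0 opprK -mulr2n Num.Theory.mulrn_eq0 /= => /eqP.
Qed.

End Exponential.

(** * Pseudo-involutory series and odd series in sqrt(z f) *)

Section PseudoInvolutory.
Context {R : numFieldType}.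
Implicit Types (f g phi : fps R).

(** The series u = f + z satisfies u o f = u, and its linear coefficient 2 makes it invertible;
    cancelling u leaves f = z. *)
Lemma fps_involution_id f : f 0%N = 0 -> f 1%N = 1 ->
  fps_comp f f = fpsX -> f = fpsX.
Proof.
move=> f0 f1 ff; pose u := f + fpsX.
have u0 : u 0%N = 0 by rewrite fpsDE f0 addr0.
have uf : fps_comp u f = u by rewrite fps_compD ff fps_comp_Xl // addrC.
have [|v [v0 vu _]] := @fps_comp_inverse _ u.
  split=> [[] //|]; rewrite fpsDE f1 fpsXE -mulr2n.
  by rewrite Num.Theory.pnatr_eq0.
by rewrite -(fps_comp_Xl f0) -vu fps_compA // uf.
Qed.

(** The linear coefficient of the involution - f squares to 1, and the value 1 would give - f =
    z. *)
Lemma pseudo_involutory_coef1 f : pseudo_involutory f -> f <> - fpsX ->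
  f 1%N = 1.
Proof.
case=> -[/(_ 0%N isT) f0 _] ff f_neq.
have Nf0 : (- f) 0%N = 0 by rewrite fpsNE f0 oppr0.
have := fps_comp_coef1 (- f) (- f); rewrite ff fpsNE mulrNN => /esym/eqP.
rewrite -expr2 sqrf_eq1 => /orP[/eqP //|/eqP f1]; case: f_neq.
by rewrite -(@fps_involution_id (- f)) ?opprK // fpsNE f1 opprK.
Qed.

Lemma sqrtXf_compN f : pseudo_involutory f -> f 1%N = 1 ->
  fps_comp (sqrtXf f) (- f) = - sqrtXf f.
Proof.
case=> -[/(_ 0%N isT) f0 _] ff f1; set s := sqrtXf f.
have Nf0 : (- f) 0%N = 0 by rewrite fpsNE f0 oppr0.
have s2 : s ^+ 2 = fpsX * f by apply: sqrtXf_sqr.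
have s1 : s 1%N = 1 by apply: sqrtXf_coef1.
have s0 : s 0%N = 0 by apply: sqrtXf_coef0.
have fNf : fps_comp f (- f) = - fpsX by rewrite -ff fps_compN opprK.
set t := fps_comp s (- f).
(* Composing with - f turns z into - f and f into - z, so the product z f is preserved. *)
have t2 : t ^+ 2 = s ^+ 2.
  rewrite s2 expr2 -fps_compM // -expr2 s2 fps_compM // fNf fps_comp_Xl //.
  by rewrite mulrNN mulrC.
(* In (s - t)(s + t) = 0 the first factor has linear coefficient 1 + 1, hence can be cancelled. *)
apply/eqP; rewrite -addr_eq0; apply/eqP; apply: (@fps_mulI _ (s - t)).
  split=> [[] // _|]; rewrite fpsDE fpsNE ?fps_comp_coef0 ?s0 ?subrr //.
  rewrite fps_comp_coef1 s1 fpsNE f1 mul1r opprK -mulr2n.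
  by rewrite Num.Theory.pnatr_eq0.
by rewrite [t + s]addrC -subr_sqr t2 subrr.
Qed.

Lemma fps_exp_odd_sqrtXf f phi : pseudo_involutory f -> f 1%N = 1 ->
  fps_odd phi ->
  let g := fps_exp (fps_comp phi (sqrtXf f)) in g * fps_comp g (- f) = 1.
Proof.
move=> hf f1 odd_phi g; have [[/(_ 0%N isT) f0 _] _] := hf.
have Nf0 : (- f) 0%N = 0 by rewrite fpsNE f0 oppr0.
have s0 := sqrtXf_coef0 f.
have phis0 : fps_comp phi (sqrtXf f) 0%N = 0.
  by rewrite fps_comp_coef0 fps_odd_coef0.
rewrite /g fps_comp_exp // fps_compA // sqrtXf_compN // fps_odd_compN //.
exact: fps_expN.
Qed.

Lemma fps_exp_odd_sqrtXf_exists f g : pseudo_involutory f -> f 1%N = 1 ->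
  g 0%N = 1 -> g * fps_comp g (- f) = 1 ->
  exists2 phi : fps R, fps_odd phi & g = fps_exp (fps_comp phi (sqrtXf f)).
Proof.
move=> hf f1 g0 gNf; have [[/(_ 0%N isT) f0 _] _] := hf.
have Nf0 : (- f) 0%N = 0 by rewrite fpsNE f0 oppr0.
have s0 := sqrtXf_coef0 f.
have Ns0 : (- sqrtXf f) 0%N = 0 by rewrite fpsNE s0 oppr0.
have [l l0 gE] := fps_exp_surj g0.
(* The exponentials of both sides are multiplicative inverses of [g], and [fps_exp] is injective. *)
have lNf : fps_comp l (- f) = - l.
  apply: fps_exp_inj; rewrite ?fps_comp_coef0 ?fpsNE ?l0 ?oppr0 //.
  rewrite -fps_comp_exp // -gE -[LHS]mul1r -(fps_expN l0) -gE.
  by rewrite mulrAC gNf mul1r.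
have [|t [t0 ts st]] := @fps_comp_inverse _ (sqrtXf f).
  by split=> [[] //|]; rewrite sqrtXf_coef1 oner_neq0.
have tsl : fps_comp (fps_comp l t) (sqrtXf f) = l.
  by rewrite fps_compA // ts fps_compX.
exists (fps_comp l t); last by rewrite tsl.
rewrite /fps_odd; set phi := fps_comp l t.
(* With s = [sqrtXf f] and z = s o t: phi o (- z) = phi o (- s) o t = phi o s o (- f) o t = l o (-
   f) o t = - (l o t). *)
rewrite -{1}st -fps_compN -fps_compA // -sqrtXf_compN //.
by rewrite -(fps_compA phi) // tsl lNf fps_compN.
Qed.

End PseudoInvolutory.

Theorem theorem2p8 (R : realType) (f : fps R)
    (hf : pseudo_involutory f) (hfX : f <> - fpsX) :
  (forall g : fps R, riordan (g, f) ->
     (pseudo_involution (g, f) <->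
      exists phi : fps R, fps_odd phi /\
        (g = fps_exp (fps_comp phi (sqrtXf f)) \/
         g = - fps_exp (fps_comp phi (sqrtXf f)))))
  /\
  (forall (phi g : fps R), fps_odd phi ->
     (g = fps_exp (fps_comp phi (sqrtXf f)) \/
      g = - fps_exp (fps_comp phi (sqrtXf f))) ->
     riordan (g, f) /\ pseudo_involution (g, f)).
Proof.
have f1 := pseudo_involutory_coef1 hf hfX.
have sufficient (phi g : fps R) : fps_odd phi ->
    (g = fps_exp (fps_comp phi (sqrtXf f)) \/
     g = - fps_exp (fps_comp phi (sqrtXf f))) -> pseudo_involution (g, f).
  move=> odd_phi gE; apply/pseudo_involutionE => //.
  by case: gE => ->; rewrite ?fps_compN ?mulrNN; apply: fps_exp_odd_sqrtXf.
split=> [g _|phi g odd_phi gE]; last first.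
  split; last exact: sufficient gE.
  split; last by case: hf.
  split=> //=; case: gE => ->; rewrite ?fpsNE fps_exp_coef0 ?oppr_eq0.
    exact: oner_neq0.
  exact: oner_neq0.
split=> [/pseudo_involutionE|[phi [odd_phi gE]]]; last exact: sufficient gE.
move=> /(_ hf) gNf.
(* The two square roots of 1 are the source of the sign in the statement. *)
have : g 0%N ^+ 2 == 1.
  by rewrite expr2 -{2}(fps_comp_coef0 g (- f)) -fps_mulE0 gNf.
rewrite sqrf_eq1 => /orP[]/eqP g0.
  have [phi odd_phi gE] := fps_exp_odd_sqrtXf_exists hf f1 g0 gNf.
  by exists phi; split=> //; left.
(* The equation for [g] is unchanged under g -> - g, which restores constant term 1. *)
have [| |phi odd_phi gE] := @fps_exp_odd_sqrtXf_exists _ f (- g) hf f1.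
- by rewrite fpsNE g0 opprK.
- by rewrite fps_compN mulrNN.
by exists phi; split=> //; right; rewrite -gE opprK.
Qed.
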